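(* For every acyclic quiver $Q$, the lattice $\mathscr{C}(S_Q)$ of all congruences on the path semigroup $S_Q$ is strong upper semimodular. However, $\mathscr{C}(S_Q)$ is not necessarily lower semimodular: there exists an acyclic quiver $Q$ such that $\mathscr{C}(S_Q)$ is not lower semimodular.
   Context: A quiver $Q=(Q_0,Q_1,s,t)$ consists of a set $Q_0$ of vertices, a set $Q_1$ of arrows, and source and target maps $s,t:Q_1\to Q_0$; it is not necessarily finite. It is acyclic if it has no oriented cycle, i.e. no path of length at least $1$ whose source equals its target. Paths are finite and include the trivial path at each vertex (identified with the vertex). Paths are composed from left to right: $\alpha\beta$ is the concatenation if $t(\alpha)=s(\beta)$ and is $0$ otherwise. The path semigroup $S_Q$ is the semigroup with zero whose nonzero elements are all paths in $Q$, with this multiplication. A congruence on a semigroup $S$ is an equivalence relation $\rho$ such that $(x,y)\in\rho$ implies $(ax,ay)\in\rho$ and $(xa,ya)\in\rho$ for all $a\in S$. $\mathscr{C}(S_Q)$ is the set of all congruences on $S_Q$, which is a complete lattice under inclusion. In a lattice $L$, $a\succ b$ ($a$ covers $b$) means $a>b$ and there is no $c\in L$ with $a>c>b$. $L$ is strong upper semimodular if $a\succ a\wedge b$ implies $a\vee b\succ b$ for all $a,b\in L$. $L$ is lower semimodular if, for all $a,b\in L$, $a\vee b\succ a$ and $a\vee b\succ b$ together imply $a\succ a\wedge b$ and $b\succ a\wedge b$. *)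

(* Defs.v *)
From Stdlib Require Import Relation_Definitions.
From HB Require Import structures.
From mathcomp Require Import all_boot all_order.
From mathcomp Require Import boolp.

Set Implicit Arguments.
Unset Strict Implicit.
Unset Printing Implicit Defensive.

Import Order.TTheory.

Record quiver : Type := Quiver {
  vertex : Type;
  arrow : Type;
  src : arrow -> vertex;
  tgt : arrow -> vertex
}.

Section Paths.
Context {Q : quiver}.

Fixpoint is_walk (v : vertex Q) (l : seq (arrow Q)) : Prop :=
  if l is a :: l' then src a = v /\ is_walk (tgt a) l' else True.

(* The source is stored separately so that the empty list of arrows at v
   encodes the trivial path at v. *)
Record qpath : Type := QPath {
  psrc : vertex Q;
  parrows : seq (arrow Q);
  pwalk : is_walk psrc parrows
}.

Definition ptgt (p : qpath) : vertex Q :=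
  last (psrc p) [seq tgt a | a <- parrows p].

Definition plength (p : qpath) : nat := size (parrows p).

Lemma qpath_inj (p q : qpath) :
  psrc p = psrc q -> parrows p = parrows q -> p = q.
Proof.
case: p q => [v l w] [v' l' w'] /= ev el; case: _ / ev w' => w'.
by case: _ / el w' => w'; rewrite (Prop_irrelevance w w').
Qed.

Lemma is_walk_cat v (l1 l2 : seq (arrow Q)) :
  is_walk v (l1 ++ l2) <->
  is_walk v l1 /\ is_walk (last v [seq tgt a | a <- l1]) l2.
Proof.
elim: l1 v => [|a l1 IH] v /=; first by split=> // -[].
by rewrite IH; tauto.
Qed.

Lemma pcomp_subproof (p q : qpath) :
  ptgt p = psrc q -> is_walk (psrc p) (parrows p ++ parrows q).
Proof.
move=> e; apply/is_walk_cat; split; first exact: pwalk.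
by rewrite -/(ptgt p) e; apply: pwalk.
Qed.

Definition pcomp (p q : qpath) (e : ptgt p = psrc q) : qpath :=
  QPath (pcomp_subproof e).

Lemma ptgt_pcomp (p q : qpath) (e : ptgt p = psrc q) :
  ptgt (pcomp e) = ptgt q.
Proof. by rewrite /ptgt /= map_cat last_cat -/(ptgt p) e. Qed.

End Paths.
Arguments qpath : clear implicits.

Definition acyclic (Q : quiver) : Prop :=
  ~ exists p : qpath Q, 0 < plength p /\ psrc p = ptgt p.

(* None is the zero element. *)
Definition path_semigroup (Q : quiver) : Type := option (qpath Q).

Section PathSemigroup.
Variable Q : quiver.

HB.instance Definition _ := gen_eqMixin (path_semigroup Q).
HB.instance Definition _ := gen_choiceMixin (path_semigroup Q).

Definition path_mul (x y : path_semigroup Q) : path_semigroup Q :=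
  match x, y with
  | Some p, Some q =>
      if pselect (ptgt p = psrc q) is left e then Some (pcomp e) else None
  | _, _ => None
  end.

Lemma path_mulA : associative path_mul.
Proof.
case=> [p|] [q|] [r|] //=; last by case: pselect.
case: (pselect (ptgt q = psrc r)) => [eqr|nqr];
  case: (pselect (ptgt p = psrc q)) => [epq|npq] //=.
- case: pselect => [e2|n2]; last by case: n2; rewrite ptgt_pcomp.
  by congr Some; apply: qpath_inj => //=; rewrite catA.
- by case: pselect => // e2; case: nqr; rewrite -(ptgt_pcomp epq).
Qed.

HB.instance Definition _ := isSemigroup.Build (path_semigroup Q) path_mulA.

End PathSemigroup.

Record congruence (S : semigroupType) : Type := Congruence {
  crel :> S -> S -> Prop;
  crel_equiv : equivalence S crel;
  crel_mull : forall a x y, crel x y -> crel (a * x)%g (a * y)%g;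
  crel_mulr : forall a x y, crel x y -> crel (x * a)%g (y * a)%g
}.

Fact congruence_display : Order.disp_t.
Proof. exact: (Order.Disp tt tt). Qed.

Section CongruenceLattice.
Variable S : semigroupType.
Implicit Types r s t : congruence S.

Lemma congruence_ext r s : (forall x y, r x y <-> s x y) -> r = s.
Proof.
case: r s => [r e l m] [s e' l' m'] /= rs.
have ers : r = s by apply/funext => x; apply/funext => y; apply/propext.
by case: _ / ers e' l' m' => e' l' m'; congr Congruence; apply: Prop_irrelevance.
Qed.

HB.instance Definition _ := gen_eqMixin (congruence S).
HB.instance Definition _ := gen_choiceMixin (congruence S).

Definition cle r s : bool := `[< forall x y, r x y -> s x y >].

Lemma cle_refl : reflexive cle.
Proof. by move=> r; apply/asboolP. Qed.

Lemma cle_anti : antisymmetric cle.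
Proof.
move=> r s /andP[/asboolP rs /asboolP sr].
by apply: congruence_ext => x y; split; [apply: rs | apply: sr].
Qed.

Lemma cle_trans : transitive cle.
Proof.
by move=> s r t /asboolP rs /asboolP st; apply/asboolP => x y /rs /st.
Qed.

HB.instance Definition _ :=
  Order.Le_isPOrder.Build congruence_display (congruence S)
    cle_refl cle_anti cle_trans.

Lemma congruence_leP r s : reflect (forall x y, r x y -> s x y) (r <= s)%O.
Proof. exact: asboolP. Qed.

Section Infimum.
Variable P : congruence S -> Prop.

Definition inf_rel (x y : S) : Prop := forall r, P r -> r x y.

Lemma inf_rel_equiv : equivalence S inf_rel.
Proof.
split.
- by move=> x r _; case: (crel_equiv r) => refl _ _; apply: refl.
- move=> x y z xy yz r Pr; case: (crel_equiv r) => _ trans _.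
  exact: trans (xy r Pr) (yz r Pr).
- by move=> x y xy r Pr; case: (crel_equiv r) => _ _; apply; apply: xy.
Qed.

Lemma inf_rel_mull a x y : inf_rel x y -> inf_rel (a * x)%g (a * y)%g.
Proof. by move=> xy r Pr; apply/crel_mull/xy. Qed.

Lemma inf_rel_mulr a x y : inf_rel x y -> inf_rel (x * a)%g (y * a)%g.
Proof. by move=> xy r Pr; apply/crel_mulr/xy. Qed.

(* The greatest lower bound of the congruences satisfying P. *)
Definition cinf : congruence S :=
  Congruence inf_rel_equiv inf_rel_mull inf_rel_mulr.

Lemma cinfE x y : cinf x y = (forall r, P r -> r x y).
Proof. by []. Qed.

End Infimum.

Definition cmeet r s : congruence S := cinf (fun t => t = r \/ t = s).

Definition cjoin r s : congruence S := cinf (fun t => r <= t /\ s <= t)%O.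

Lemma cle_meet r s t : (r <= cmeet s t)%O = (r <= s)%O && (r <= t)%O.
Proof.
apply/congruence_leP/andP => [h|[/congruence_leP rs /congruence_leP rt] x y].
  split; apply/congruence_leP => x y /h; rewrite cinfE; apply;
    by [left | right].
by rewrite cinfE => rxy u [->|->]; [apply: rs | apply: rt].
Qed.

Lemma cjoin_le r s t : (cjoin r s <= t)%O = (r <= t)%O && (s <= t)%O.
Proof.
apply/congruence_leP/andP => [h|[rt st] x y]; last first.
  by rewrite cinfE; apply; split.
split; apply/congruence_leP => x y xy; apply: h; rewrite cinfE => u.
- by move=> [/congruence_leP ru _]; apply: ru.
- by move=> [_ /congruence_leP su]; apply: su.
Qed.

HB.instance Definition _ :=
  Order.POrder_MeetJoin_isLattice.Build congruence_display (congruence S)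
    cle_meet cjoin_le.

Lemma congruence_meetE r s x y : (r `&` s)%O x y <-> r x y /\ s x y.
Proof.
rewrite [(r `&` s)%O]/(cmeet r s) cinfE; split=> [h|[rxy sxy] t [->|->]//].
by split; apply: h; [left | right].
Qed.

End CongruenceLattice.

Section Semimodularity.
Context {d : Order.disp_t}.

Definition covers (L : latticeType d) (a b : L) : Prop :=
  (b < a)%O /\ ~ exists c : L, (b < c)%O /\ (c < a)%O.

Definition strong_upper_semimodular (L : latticeType d) : Prop :=
  forall a b : L, covers a (a `&` b)%O -> covers (a `|` b)%O b.

Definition lower_semimodular (L : latticeType d) : Prop :=
  forall a b : L,
    covers (a `|` b)%O a -> covers (a `|` b)%O b ->
    covers a (a `&` b)%O /\ covers b (a `&` b)%O.

End Semimodularity.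

(* Main.v *)
(** If [r] covers [s], then acyclicity yields a pair [(x, y)] in [r] but not in
    [s] whose translates are either [(x, y)] itself or already in [s]: a proper
    translate is never parallel to [x], so it generates with [s] a congruence
    missing [(x, y)], which must be [s]. Merging the classes of such a pair is
    always a cover, over [s] as well as over any larger congruence not
    containing the pair, and this gives strong upper semimodularity. For four
    parallel arrows every equivalence on the arrows is a congruence, so the
    congruence lattice inherits the failure of lower semimodularity of the
    partition lattice of a four-element set. *)
Require Import Defs.
From Stdlib Require Import Relation_Definitions.
From mathcomp Require Import all_boot all_order.
From mathcomp Require Import boolp.

Set Implicit Arguments.
Unset Strict Implicit.
Unset Printing Implicit Defensive.

Import Order.TTheory.
Local Open Scope group_scope.

(** * Merging two classes of a congruence *)

Section Merge.
Variable S : semigroupType.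
Implicit Types (r s t : congruence S) (x y z a b : S).

Lemma crefl r x : r x x.
Proof. by case: (crel_equiv r) => h _ _; apply: h. Qed.

Lemma csym r x y : r x y -> r y x.
Proof. by case: (crel_equiv r) => _ _ h; apply: h. Qed.

Lemma ctrans r y x z : r x y -> r y z -> r x z.
Proof. by case: (crel_equiv r) => _ h _; apply: h. Qed.

Lemma clt_witness r s : (r < s)%O -> exists x y, s x y /\ ~ r x y.
Proof.
move=> /lt_geF /negP nle; apply: contrapT => nex; apply: nle.
apply/congruence_leP => x y sxy; apply: contrapT => nrxy.
by apply: nex; exists x, y.
Qed.

Lemma clt_of_witness r s x y : (r <= s)%O -> s x y -> ~ r x y -> (r < s)%O.
Proof.
move=> rs sxy nrxy; rewrite lt_neqAle rs andbT.
by apply/eqP => e; apply: nrxy; rewrite e.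
Qed.

(** The condition on a pair that lets its two classes be merged without forcing any further
    identification. *)
Definition critical r x y : Prop :=
  (forall a, r (a * x) (a * y) \/ a * x = x /\ a * y = y) /\
  (forall a, r (x * a) (y * a) \/ x * a = x /\ y * a = y).

Lemma critical_le r s x y : (r <= s)%O -> critical r x y -> critical s x y.
Proof.
move=> /congruence_leP rs [hl hr].
by split=> a; [case: (hl a) | case: (hr a)] => h; [left; apply: rs | right
  | left; apply: rs | right].
Qed.

(** The join of the classes of [x] and [y] is written out directly: as [r] is transitive, a single
    passage between the two classes is enough. *)
Definition merge_rel r x y u v : Prop :=
  r u v \/ (r u x /\ r y v) \/ (r u y /\ r x v).

Lemma merge_equiv r x y : equivalence S (merge_rel r x y).
Proof.
have tr := @ctrans r; have sy := @csym r.
split.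
- by move=> u; left; apply: crefl.
- move=> u v w [uv|[[ux yv]|[uy xv]]] [vw|[[vx yw]|[vy xw]]].
  + by left; apply: tr vw.
  + by right; left; split=> //; apply: tr vx.
  + by right; right; split=> //; apply: tr vy.
  + by right; left; split=> //; apply: tr vw.
  + by right; left.
  + by left; apply: tr xw.
  + by right; right; split=> //; apply: tr vw.
  + by left; apply: tr yw.
  + by right; right.
- move=> u v [uv|[[ux yv]|[uy xv]]]; first by left; apply: sy.
  + by right; right; split; apply: sy.
  + by right; left; split; apply: sy.
Qed.

Section MergeCongruence.
Variables (r : congruence S) (x y : S).
Hypothesis crit : critical r x y.

Lemma merge_mull a u v :
  merge_rel r x y u v -> merge_rel r x y (a * u) (a * v).
Proof.
have [/(_ a) h _] := crit.
case=> [uv|[[ux yv]|[uy xv]]]; first by left; apply: crel_mull.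
- have := crel_mull a ux; have := crel_mull a yv.
  case: h => [h|[-> ->]] yv' ux'; last by right; left.
  by left; apply: ctrans ux' (ctrans h yv').
- have := crel_mull a uy; have := crel_mull a xv.
  case: h => [h|[-> ->]] xv' uy'; last by right; right.
  by left; apply: ctrans uy' (ctrans (csym h) xv').
Qed.

Lemma merge_mulr a u v :
  merge_rel r x y u v -> merge_rel r x y (u * a) (v * a).
Proof.
have [_ /(_ a) h] := crit.
case=> [uv|[[ux yv]|[uy xv]]]; first by left; apply: crel_mulr.
- have := crel_mulr a ux; have := crel_mulr a yv.
  case: h => [h|[-> ->]] yv' ux'; last by right; left.
  by left; apply: ctrans ux' (ctrans h yv').
- have := crel_mulr a uy; have := crel_mulr a xv.
  case: h => [h|[-> ->]] xv' uy'; last by right; right.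
  by left; apply: ctrans uy' (ctrans (csym h) xv').
Qed.

Definition merge : congruence S :=
  Congruence (merge_equiv r x y) merge_mull merge_mulr.

Lemma merge_pair : merge x y.
Proof. by right; left; split; apply: crefl. Qed.

Lemma le_merge : (r <= merge)%O.
Proof. by apply/congruence_leP => u v; left. Qed.

Lemma merge_le t : (r <= t)%O -> t x y -> (merge <= t)%O.
Proof.
move=> /congruence_leP rt txy.
apply/congruence_leP => u v [uv|[[/rt ux /rt yv]|[/rt uy /rt xv]]].
- exact: rt.
- exact: ctrans ux (ctrans txy yv).
- exact: ctrans uy (ctrans (csym txy) xv).
Qed.

(** A congruence strictly above [r] and inside [merge] relates some member of the class of [x] to
    some member of the class of [y]. By transitivity it contains [(x, y)], hence all of [merge]. *)
Lemma covers_merge : ~ r x y -> covers merge r.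
Proof.
move=> nxy; split; first exact: clt_of_witness le_merge merge_pair nxy.
case=> t [rt tm]; have [u [v [tuv nuv]]] := clt_witness rt.
have /congruence_leP rt' := ltW rt.
have /congruence_leP tm' := ltW tm.
suff txy : t x y by have := lt_geF tm; rewrite merge_le // ltW.
case: (tm' _ _ tuv) => [//|[[/rt' ux /rt' yv]|[/rt' uy /rt' xv]]].
- exact: ctrans (csym ux) (ctrans tuv (csym yv)).
- exact: ctrans xv (ctrans (csym tuv) uy).
Qed.

End MergeCongruence.

(** The same pair is merged twice: over the meet this yields [r], and over [s], where the pair is
    still critical and still unrelated, it yields the join. *)
Lemma covers_join_of_critical r s x y :
  covers r (r `&` s)%O -> r x y -> ~ (r `&` s)%O x y ->
  critical (r `&` s)%O x y -> covers (r `|` s)%O s.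
Proof.
move=> [_ nbetween] rxy nxy crit.
have nsxy : ~ s x y by move=> sxy; apply: nxy; apply/congruence_meetE.
have crit' : critical s x y by apply: critical_le crit; apply: leIr.
have -> : (r `|` s = merge crit')%O; last exact: covers_merge.
apply: le_anti; apply/andP; split; last first.
  apply: merge_le; first exact: leUr.
  by have /congruence_leP := leUl r s; apply.
rewrite leUx le_merge andbT.
(* The merge lies strictly above the meet and below [r], so the cover leaves no room for it to
   differ from [r]. *)
have <- : merge crit = r.
  apply/eqP; rewrite eq_le merge_le ?leIl //=.
  apply/negPn/negP => nle; apply: nbetween; exists (merge crit).
  split; first by have [] := covers_merge crit nxy.
  by rewrite lt_leAnge merge_le ?leIl.
apply: merge_le; last exact: merge_pair.
exact: le_trans (leIr _ _) (le_merge _).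
Qed.

End Merge.

(** * Paths, vertex idempotents and acyclicity *)

Section PathSemigroupTheory.
Variable Q : quiver.
Local Notation S := (path_semigroup Q).
Implicit Types (x y z a b c : S) (p q : qpath Q) (v w : vertex Q).

Definition triv v : qpath Q := @QPath Q v [::] I.
Definition idem v : S := Some (triv v).

Lemma path_mul0p x : (None : S) * x = None.
Proof. by []. Qed.

Lemma path_mulp0 x : x * (None : S) = None.
Proof. by case: x. Qed.

Lemma path_mulSome p q (e : ptgt p = psrc q) :
  (Some p : S) * Some q = Some (Defs.pcomp e).
Proof.
rewrite /mul /=; case: pselect => //= e'.
by congr Some; apply: qpath_inj.
Qed.

Lemma path_mul_neq p q : ptgt p <> psrc q -> (Some p : S) * Some q = None.
Proof. by move=> ne; rewrite /mul /=; case: pselect. Qed.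

Lemma idem_mulE v p :
  idem v * Some p = if pselect (v = psrc p) then Some p else None.
Proof.
case: pselect => [e|ne]; last exact: path_mul_neq.
by rewrite (path_mulSome (p := triv v) e); congr Some; apply: qpath_inj.
Qed.

Lemma mul_idemE p v :
  (Some p : S) * idem v = if pselect (ptgt p = v) then Some p else None.
Proof.
case: pselect => [e|ne]; last exact: path_mul_neq.
rewrite (path_mulSome (q := triv v) e); congr Some; apply: qpath_inj => //=.
exact: cats0.
Qed.

Lemma idemK v : idem v * idem v = idem v.
Proof. by rewrite idem_mulE; case: pselect. Qed.

Lemma corner_Some p : idem (psrc p) * Some p * idem (ptgt p) = Some p.
Proof.
by rewrite idem_mulE; case: pselect => //= _; rewrite mul_idemE; case: pselect.
Qed.

Lemma corner_id_or0 v w y :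
  idem v * y * idem w = y \/ idem v * y * idem w = None.
Proof.
case: y => [p|]; last by left.
rewrite idem_mulE; case: pselect => /= _; last by right.
by rewrite mul_idemE; case: pselect => /= _; [left | right].
Qed.

(** Suppose all corners were related. Cutting at the endpoints of the path [x] fixes [x] and sends
    [y] to itself or to zero, so [x] is related to [y] or to zero. The same holds with the roles
    exchanged, and zero then links [x] to [y]. *)
Lemma corner_separation (r : congruence S) x y :
  ~ r x y -> exists v w,
    ~ r (idem v * x * idem w) (idem v * y * idem w).
Proof.
move=> nxy; apply: contrapT => nex; apply: nxy.
have h v w : r (idem v * x * idem w) (idem v * y * idem w).
  by apply: contrapT => n; apply: nex; exists v, w.
have x0 p : x = Some p -> r x y \/ r x None.
  move=> ex; have := h (psrc p) (ptgt p); rewrite ex corner_Some.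
  by case: (corner_id_or0 (psrc p) (ptgt p) y) => -> ?; [left | right].
have y0 p : y = Some p -> r x y \/ r None y.
  move=> ey; have := h (psrc p) (ptgt p); rewrite ey corner_Some.
  by case: (corner_id_or0 (psrc p) (ptgt p) x) => -> ?; [left | right].
have [//|rx] : r x y \/ r x None.
  by case E: x => [p|]; [rewrite -E; apply: (x0 p) | right; apply: crefl].
have [//|ry] : r x y \/ r None y.
  by case E: y => [p|]; [rewrite -E; apply: (y0 p) | right; apply: crefl].
exact: ctrans rx ry.
Qed.

Hypothesis acyc : acyclic Q.

Lemma cycle_arrows p : psrc p = ptgt p -> parrows p = [::].
Proof.
move=> e; case E: (parrows p) => [//|a l]; case: acyc.
by exists p; rewrite /plength E.
Qed.

(** This is where acyclicity enters: a nonzero product makes [c * a] a closed path at [v], hence one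
    without arrows, so both factors are the trivial path at [v]. *)
Lemma idem_factor v c a :
  idem v * c * a * idem v <> None ->
  a * idem v = idem v /\ idem v * c = idem v.
Proof.
case: c => [c|]; last by rewrite path_mulp0.
case: a => [a|]; last by rewrite path_mulp0.
rewrite idem_mulE; case: pselect => //= ec.
case: (pselect (ptgt c = psrc a)) => [e|ne]; last by rewrite path_mul_neq.
rewrite (path_mulSome e) !mul_idemE; case: pselect => //= et _.
have := @cycle_arrows (Defs.pcomp e) _; rewrite et => /(_ (esym ec)) /=.
case: c a e ec et => [sc [|//] wc] [sa [|//] wa] /= e ec et _.
have {}et : sa = v by rewrite -e -et /ptgt /=.
case: pselect => [ea|[]]; last by rewrite /ptgt /=.
by split; congr Some; apply: qpath_inj.
Qed.

Lemma idem_left_dichotomy v a :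
  a * idem v = idem v \/ forall c, idem v * c * a * idem v = None.
Proof.
case: (pselect (a * idem v = idem v)) => [|na]; [by left | right=> c].
by apply: contrapT => /idem_factor[].
Qed.

Lemma idem_right_dichotomy w b :
  idem w * b = idem w \/ forall c, idem w * b * c * idem w = None.
Proof.
case: (pselect (idem w * b = idem w)) => [|nb]; [by left | right=> c].
by apply: contrapT => /idem_factor[].
Qed.

Section CornerTrace.
Variables (r s : congruence S) (v w : vertex Q).

(** The largest congruence inside [r] whose pairs in the corner [idem v * S * idem w] all lie in
    [s]. *)
Definition trace_rel x y : Prop :=
  r x y /\ forall c d,
    s (idem v * c * x * d * idem w) (idem v * c * y * d * idem w).

Lemma trace_equiv : equivalence S trace_rel.
Proof.
split.
- by move=> x; split=> [|c d]; apply: crefl.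
- move=> x y z [rxy h] [ryz k]; split; first exact: ctrans rxy ryz.
  by move=> c d; apply: ctrans (h c d) (k c d).
- by move=> x y [rxy h]; split=> [|c d]; apply: csym.
Qed.

Lemma trace_mull a x y : trace_rel x y -> trace_rel (a * x) (a * y).
Proof.
move=> [rxy h]; split=> [|c d]; first exact: crel_mull.
by have := h (c * a) d; rewrite !mulgA.
Qed.

Lemma trace_mulr a x y : trace_rel x y -> trace_rel (x * a) (y * a).
Proof.
move=> [rxy h]; split=> [|c d]; first exact: crel_mulr.
by have := h c (a * d); rewrite !mulgA.
Qed.

Definition trace : congruence S :=
  Congruence trace_equiv trace_mull trace_mulr.

Lemma trace_le : (trace <= r)%O.
Proof. by apply/congruence_leP => x y []. Qed.

Lemma le_trace : (s <= r)%O -> (s <= trace)%O.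
Proof.
move=> /congruence_leP sr; apply/congruence_leP => x y sxy; split.
  exact: sr.
by move=> c d; do 2!apply: crel_mulr; apply: crel_mull.
Qed.

End CornerTrace.

(** A separated pair is first moved into a corner. The trace of [s] on that corner misses the pair,
    so it equals [s]. A translate that moves the pair is invisible from the corner, because
    returning there would close a cycle; it therefore lies in the trace. *)
Lemma covers_critical (r s : congruence S) :
  covers r s -> exists x y, [/\ r x y, ~ s x y & critical s x y].
Proof.
move=> [lt_sr nbetween].
have [x0 [y0 [rxy0 /corner_separation [v [w nsxy]]]]] := clt_witness lt_sr.
set x := _ * x0 * _ in nsxy; set y := _ * y0 * _ in nsxy.
have rxy : r x y by apply: crel_mulr; apply: crel_mull.
have vx z : idem v * (idem v * z * idem w) = idem v * z * idem w.
  by rewrite !mulgA idemK.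
have xw z : (idem v * z * idem w) * idem w = idem v * z * idem w.
  by rewrite -!mulgA idemK.
(* Testing with [c] and [d] equal to the corner idempotents recovers the pair itself. *)
have ntr : ~ trace r s v w x y.
  by move=> [_ /(_ (idem v) (idem w))]; rewrite idemK !vx !xw.
(* The trace lies between [s] and [r] and differs from [r], so the cover collapses it to [s]. *)
have sub a b : trace r s v w a b -> s a b.
  move=> tab; apply: contrapT => nsab; apply: nbetween.
  exists (trace r s v w); split.
    exact: clt_of_witness (le_trace v w (ltW lt_sr)) tab nsab.
  exact: clt_of_witness (trace_le r s v w) rxy ntr.
exists x, y; split=> //; split=> a.
- case: (idem_left_dichotomy v a) => [av|h]; [right | left].
    by rewrite /x /y !mulgA av.
  apply: sub; split; first exact: crel_mull.
  by move=> c d; rewrite /x /y !mulgA !h !path_mul0p; apply: crefl.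
- case: (idem_right_dichotomy w a) => [wa|h]; [right | left].
    by rewrite /x /y -!(mulgA _ (idem w)) wa.
  apply: sub; split; first exact: crel_mulr.
  move=> c d.
  have k z : idem v * c * (idem v * z * idem w * a) * d * idem w = None.
    (* Regrouping isolates the factor from [w] back to [w], which [h] makes zero. *)
    transitivity (idem v * c * idem v * z * (idem w * a * d * idem w)).
      by rewrite !mulgA.
    by rewrite h path_mulp0.
  by rewrite /x /y !k; apply: crefl.
Qed.

End PathSemigroupTheory.

Lemma path_congruences_strong_upper_semimodular (Q : quiver) :
  acyclic Q -> strong_upper_semimodular (congruence (path_semigroup Q)).
Proof.
move=> acyc r s cov.
have [x [y [rxy nxy crit]]] := covers_critical acyc cov.
exact: covers_join_of_critical rxy nxy crit.
Qed.

(** * Congruences on parallel arrows *)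

Section Kronecker.
Variable A : Type.

Definition kronecker : quiver := @Quiver bool A (fun=> false) (fun=> true).
Local Notation S := (path_semigroup kronecker).

Lemma kronecker_walk v l :
  @is_walk kronecker v l -> l = [::] \/ v = false /\ exists a, l = [:: a].
Proof.
case: l => [|a [|b l]] /=; first by left.
  by move=> [<- _]; right; split=> //; exists a.
by move=> [_ []].
Qed.

Lemma kronecker_acyclic : acyclic kronecker.
Proof.
move=> [[v l wl] []]; rewrite /plength /ptgt /=.
by have [->|[-> [a ->]]] := kronecker_walk wl.
Qed.

Definition kpath (a : A) : qpath kronecker :=
  @QPath kronecker false [:: a] (conj erefl I).

Definition karrow (a : A) : S := Some (kpath a).

(** The alternative is uniform in [a], so multiplication sends a pair of arrows to itself or to a
    pair of zeros; this makes [kernel_rel] compatible with multiplication. *)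
Lemma mul_karrow (x : S) :
  (forall a, x * karrow a = karrow a) \/ (forall a, x * karrow a = None).
Proof.
case: x => [p|]; last by right.
case: (pselect (ptgt p = false)) => [e|ne]; [left | right] => a; last first.
  exact: path_mul_neq.
rewrite (path_mulSome (q := kpath a) e); congr Some.
case: p e => v l wl; rewrite /ptgt /= => e; apply: qpath_inj => /=;
  by case: (kronecker_walk wl) e => [->|[_ [b ->]]].
Qed.

Lemma karrow_mul (x : S) :
  (forall a, karrow a * x = karrow a) \/ (forall a, karrow a * x = None).
Proof.
case: x => [p|]; last by right.
case: (pselect (true = psrc p)) => [e|ne]; [left | right] => a; last first.
  exact: path_mul_neq.
rewrite (path_mulSome (p := kpath a) e); congr Some; apply: qpath_inj => //=.
case: p e => v l wl /= e.
by have [->|[ev]] := kronecker_walk wl; [|rewrite -e in ev].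
Qed.

Lemma karrow_inj a b : karrow a = karrow b -> a = b.
Proof. by move=> []. Qed.

Section Kernel.
Variables (T : Type) (f : A -> T).

(** Partitions of the arrows are encoded as fibres of a map [f]; every element other than an arrow
    forms a class by itself. *)
Definition kernel_rel (x y : S) : Prop :=
  x = y \/ exists a b, [/\ x = karrow a, y = karrow b & f a = f b].

Lemma kernel_equiv : equivalence S kernel_rel.
Proof.
split.
- by move=> x; left.
- move=> x y z [->//|[a [b [-> -> e]]]].
  case=> [<-|[b' [c [/karrow_inj <- -> e']]]]; right; first by exists a, b.
  by exists a, c; rewrite e.
- by move=> x y [->|[a [b [-> -> e]]]]; [left | right; exists b, a].
Qed.

Lemma kernel_mull z x y : kernel_rel x y -> kernel_rel (z * x) (z * y).
Proof.
case=> [->|[a [b [-> -> e]]]]; first by left.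
by case: (mul_karrow z) => h; rewrite !h; [right; exists a, b | left].
Qed.

Lemma kernel_mulr z x y : kernel_rel x y -> kernel_rel (x * z) (y * z).
Proof.
case=> [->|[a [b [-> -> e]]]]; first by left.
by case: (karrow_mul z) => h; rewrite !h; [right; exists a, b | left].
Qed.

Definition kernel : congruence S :=
  Congruence kernel_equiv kernel_mull kernel_mulr.

Lemma kernel_karrow a b : kernel (karrow a) (karrow b) <-> f a = f b.
Proof.
split=> [[/karrow_inj ->//|[a' [b' [/karrow_inj -> /karrow_inj ->]]]]//|e].
by right; exists a, b.
Qed.

Lemma kernel_le (r : congruence S) :
  (forall a b, f a = f b -> r (karrow a) (karrow b)) -> (kernel <= r)%O.
Proof.
move=> h; apply/congruence_leP => x y [->|[a [b [-> -> /h]]]//].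
exact: crefl.
Qed.

End Kernel.

(** There are only two fibres. A strictly larger [t] links some [c] and [d] in different fibres, and
    any two arrows can then be joined through that link. *)
Lemma covers_kernel (f : A -> bool) a b :
  f a <> f b -> covers (kernel (fun=> tt)) (kernel f).
Proof.
move=> nab; split.
  apply: (@clt_of_witness _ _ _ (karrow a) (karrow b)).
  - by apply: kernel_le => ? ? _; apply/kernel_karrow.
  - exact/kernel_karrow.
  - by rewrite kernel_karrow.
case=> t [ft tT]; have [x [y [txy nxy]]] := clt_witness ft.
have /congruence_leP /(_ _ _ txy) := ltW tT.
case=> [exy|[c [d [ex ey _]]]]; first by apply: nxy; rewrite exy; apply: crefl.
move: txy nxy; rewrite {}ex {}ey kernel_karrow => tcd ncd.
suff le : (kernel (fun=> tt) <= t)%O by have := lt_geF tT; rewrite le.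
have tf i j : f i = f j -> t (karrow i) (karrow j).
  by move=> e; have /congruence_leP := ltW ft; apply; apply/kernel_karrow.
apply: kernel_le => i j _.
case: (pselect (f i = f j)) => [/tf//|nij].
case: (pselect (f i = f c)) => [ic|nic].
  apply: ctrans (tf _ _ ic) (ctrans tcd (tf _ _ _)).
  by case: (f i) (f j) (f c) (f d) nij ic ncd => [] [] [] [].
apply: (ctrans (tf i d _) (ctrans (csym tcd) (tf c j _))).
- by case: (f i) (f c) (f d) nic ncd => [] [] [].
- by case: (f i) (f j) (f c) nij nic => [] [] [].
Qed.

End Kronecker.

(** The four arrows form a two by two grid, with [r] and [s] its partitions by first and by second
    coordinate. Each is covered by the join, but their meet is equality, which [r] does not
    cover. *)
Lemma kronecker_not_lower_semimodular :
  ~ lower_semimodular (congruence (path_semigroup (kronecker (bool * bool)))).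
Proof.
pose r := kernel (@fst bool bool); pose s := kernel (@snd bool bool).
have joinE : (r `|` s)%O = kernel (fun _ : bool * bool => tt).
  apply: le_anti; apply/andP; split.
    by rewrite leUx; apply/andP; split; apply: kernel_le => ? ? _;
      apply/kernel_karrow.
  (* The grid point [(a, d)] shares its first coordinate with one arrow and its second with the
     other. *)
  apply: kernel_le => [[a b] [c d]] _; apply: (@ctrans _ _ (karrow (a, d))).
    by have /congruence_leP := leUl r s; apply; apply/kernel_karrow.
  by have /congruence_leP := leUr s r; apply; apply/kernel_karrow.
move=> /(_ r s); rewrite joinE.
case; [exact: (@covers_kernel _ _ (true, true) (false, true))
  | exact: (@covers_kernel _ _ (true, true) (true, false)) | ].
move=> [_ nbetween] _; apply: nbetween.
(* This map keeps one class of [r] whole and splits the other into singletons, giving a congruence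
   strictly between the meet and [r]. *)
pose g (a : bool * bool) := if a.1 then None else Some a.2.
exists (kernel g); split.
- apply: (@clt_of_witness _ _ _ (karrow (true, true)) (karrow (true, false))).
  + apply/congruence_leP => x y /congruence_meetE[].
    case=> [->|[[a b] [[c d] [-> -> /= <-]]]] => [_|]; first exact: crefl.
    by move=> /kernel_karrow /= <-; left.
  + exact/kernel_karrow.
  + by move=> /congruence_meetE[_ /kernel_karrow].
- apply: (@clt_of_witness _ _ _ (karrow (false, true)) (karrow (false, false))).
  + by apply: kernel_le => [[[] a] [[] b]] //= _; apply/kernel_karrow.
  + exact/kernel_karrow.
  + by rewrite kernel_karrow.
Qed.

Theorem theorem1p2 :
  (forall Q : quiver,
     acyclic Q -> strong_upper_semimodular (congruence (path_semigroup Q))) /\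
  (exists Q : quiver,
     acyclic Q /\ ~ lower_semimodular (congruence (path_semigroup Q))).
Proof.
split; first exact: path_congruences_strong_upper_semimodular.
exists (kronecker (bool * bool)); split; first exact: kronecker_acyclic.
exact: kronecker_not_lower_semimodular.
Qed.
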